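(* Let $k\geq 1$ be an integer and let $G$ be a balanced bipartite graph of order $2n$, where $n\geq k^3+2k+4$. If $G$ is a subgraph of $B^k_n$ and $\delta(G)\geq k$, then $\lambda(G)<\sqrt{n(n-k)}$, unless $G=B^k_n$.
   Context: All graphs are finite and simple. $\lambda(G)$ denotes the spectral radius (largest eigenvalue) of the adjacency matrix of $G$, and $\delta(G)$ its minimum degree. A bipartite graph is balanced if its two parts have the same size. For $n\geq 2k+1$, $B^k_n$ denotes the graph obtained from the complete bipartite graph $K_{n,n}$ by deleting the edges of a complete bipartite subgraph $K_{k,n-k}$ (with $k$ vertices in one part of $K_{n,n}$ and $n-k$ vertices in the other part). *)

(* Defs.v *)
From HB Require Import structures.
From mathcomp Require Import all_boot all_order all_algebra.
From mathcomp Require Import classical_sets reals.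

Set Implicit Arguments.
Unset Strict Implicit.
Unset Printing Implicit Defensive.

Import Order.TTheory GRing.Theory Num.Theory.
Local Open Scope ring_scope.

Record sgraph := SGraph {
  vertex :> finType;
  adj : rel vertex;
  adj_sym : symmetric adj;
  adj_irr : irreflexive adj }.

Definition degree (G : sgraph) (x : G) : nat := #|[set y | adj x y]|.

(* Every degree is smaller than [#|G|], so the default value [#|G|] plays no
   role unless [G] has no vertex. *)
Definition min_degree (G : sgraph) : nat :=
  \big[minn/#|G|]_(x : G) degree x.

Definition adj_mx (R : realType) (G : sgraph) : 'M[R]_#|G| :=
  \matrix_(i, j) (adj (enum_val i) (enum_val j))%:R.

(* The eigenvalues of a real symmetric matrix of positive size form a finite
   nonempty set, whose supremum is the largest eigenvalue. *)
Definition spectral_radius (R : realType) (G : sgraph) : R :=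
  sup [set a : R | eigenvalue (adj_mx R G) a]%classic.

Definition balanced_bipartite (G : sgraph) : Prop :=
  exists A : {set G},
    #|A| = #|~: A| /\ forall x y : G, adj x y -> (x \in A) != (y \in A).

(* Subgraph and equality are taken up to isomorphism. *)
Definition is_subgraph (G H : sgraph) : Prop :=
  exists2 f : G -> H, injective f & forall x y, adj x y -> adj (f x) (f y).

Definition isomorphic (G H : sgraph) : Prop :=
  exists2 f : G -> H, bijective f & forall x y, adj (f x) (f y) = adj x y.

(* The complete bipartite graph on ['I_n + 'I_n], minus the edges joining the
   first [k] vertices of the left part to the first [n - k] of the right. *)
Definition Bgraph_adj (n k : nat) : rel ('I_n + 'I_n) := fun u v =>
  match u, v with
  | inl i, inr j | inr j, inl i => ~~ ((i < k) && (j < n - k))%N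
  | _, _ => false
  end.

Lemma Bgraph_adj_sym n k : symmetric (@Bgraph_adj n k).
Proof. by case=> i [j|j]. Qed.

Lemma Bgraph_adj_irr n k : irreflexive (@Bgraph_adj n k).
Proof. by case. Qed.

Definition Bgraph (n k : nat) : sgraph :=
  SGraph (@Bgraph_adj_sym n k) (@Bgraph_adj_irr n k).

(* Main.v *)
(** Write [m = n - k] and [mu = sqrt (n m)].  A positive vector [w] with
    [A w < mu w] entrywise forces [lambda < mu].  The [k] vertices of [B^k_n] of
    degree [k] keep all their edges in [G], so some edge [i0 j0] with
    [k <= i0] is missing.  The vector [w] perturbs the Perron vector of the
    subgraph [K_{m,n}]: on the left it is [a] on the first [k] vertices and [1]
    on the others; on the right it is, up to the factor [1 / mu] and a small
    [eps], the vector of neighbour sums, lowered by [1] at [j0].  The rows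
    of left vertices of weight [1] then need [k^2 a + n eps < 1], those of
    weight [a] need roughly [a > k / n], and both can be met as soon as
    [n] exceeds [k^3] by a little. *)
Require Import Defs.
From HB Require Import structures.
From mathcomp Require Import all_boot all_order all_algebra.
From mathcomp Require Import classical_sets reals.
From mathcomp Require Import ring lra zify.

Set Implicit Arguments.
Unset Strict Implicit.
Unset Printing Implicit Defensive.

Import Order.TTheory GRing.Theory Num.Theory.
Local Open Scope ring_scope.

(** At an index [i] maximizing [q i = |v_i| / w_i], the eigenvalue equation gives [a |v_i| <= sum
    |v_y| <= q i * sum w_y <= mu |v_i|], with sums over the neighbours [y] of [i]. *)
Lemma eigenvalue_le_weight (R : realType) (G : sgraph) (w : G -> R) (mu a : R) :
  (forall x, 0 < w x) ->
  (forall x, \sum_(y | adj x y) w y <= mu * w x) ->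
  eigenvalue (adj_mx R G) a -> a <= mu.
Proof.
move=> w_gt0 wle /eigenvalueP[v va /rV0Pn[i0 vi0]].
pose q (i : 'I_#|G|) := `|v 0 i| / w (enum_val i).
case: (@arg_maxP _ _ _ i0 predT q isT) => i _ qmax.
have wi_gt0 := w_gt0 (enum_val i).
have vi_gt0 : 0 < `|v 0 i|.
  have : 0 < q i by apply: lt_le_trans (qmax i0 isT); rewrite divr_gt0 ?normr_gt0.
  by rewrite /q pmulr_lgt0 ?invr_gt0.
rewrite -(ler_pM2r vi_gt0); apply: le_trans (_ : `|a * v 0 i| <= _).
  by rewrite normrM ler_pM2r // ler_norm.
have -> : a * v 0 i = \sum_(y | adj (enum_val i) y) v 0 (enum_rank y).
  have := congr1 (fun M : 'rV_#|G| => M 0 i) va; rewrite !mxE => <-.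
  rewrite (reindex _ (onW_bij _ (enum_rank_bij G))) /= [RHS]big_mkcond /=.
  apply: eq_bigr => y _; rewrite mxE enum_rankK adj_sym.
  by case: adj; rewrite ?mulr1 ?mulr0.
apply: le_trans (ler_norm_sum _ _ _) _.
apply: le_trans (_ : \sum_(y | adj (enum_val i) y) q i * w y <= _).
  apply: ler_sum => y _; rewrite -ler_pdivrMr //.
  by rewrite -{2}(enum_rankK y); apply: (qmax (enum_rank y)).
rewrite -mulr_sumr; apply: le_trans (_ : q i * (mu * w (enum_val i)) <= _).
  by rewrite ler_wpM2l // /q divr_ge0 // ltW.
by rewrite /q mulrCA divfK // gt_eqF.
Qed.

(* The maximum [nu] of the ratios [(A w) x / w x] bounds every eigenvalue, which
   keeps the inequality strict in the supremum. *)
Lemma spectral_radius_lt_weight (R : realType) (G : sgraph) (w : G -> R) (mu : R) :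
  0 < mu -> (forall x, 0 < w x) ->
  (forall x, \sum_(y | adj x y) w y < mu * w x) ->
  spectral_radius R G < mu.
Proof.
move=> mu_gt0 w_gt0 wlt.
pose nu := \big[Num.max/0]_(x : G) ((\sum_(y | adj x y) w y) / w x).
have nu_lt : nu < mu by apply: bigmax_lt => // x _; rewrite ltr_pdivrMr.
apply: le_lt_trans nu_lt; rewrite /spectral_radius.
set E := (X in sup X).
have nu_ub : ubound E nu.
  move=> a /=; apply: (@eigenvalue_le_weight _ _ w) => // x.
  by rewrite -ler_pdivrMr //; apply: le_bigmax.
(* For empty [E] the supremum has the default value 0, and [nu], a maximum started at 0, is
   nonnegative. *)
have [->|/set0P E0] := eqVneq E set0; last exact: ge_sup.
by rewrite sup0; apply: bigmax_ge_id.
Qed.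

(** Over a semiring, so that it serves both real weights and a cardinality in [nat]. *)
Lemma sum_ord_lt (R : nzSemiRingType) (n k : nat) (a b : R) : (k <= n)%N ->
  \sum_(i < n) (if (i < k)%N then a else b) = k%:R * a + (n - k)%:R * b.
Proof.
move=> kn; rewrite -(big_mkord xpredT (fun i => if (i < k)%N then a else b)).
rewrite (@big_cat_nat _ _ _ k) //=.
rewrite (@eq_big_nat _ _ _ 0 k _ (fun=> a)); last by move=> i /andP[_ ->].
rewrite (@eq_big_nat _ _ _ k n _ (fun=> b)); last first.
  by move=> i /andP[ki _]; rewrite ltnNge ki.
by rewrite !sumr_const_nat subn0 !mulr_natl.
Qed.

Section TestVector.
Variables (R : realType) (n k : nat) (e : rel ('I_n + 'I_n)) (i0 j0 : 'I_n).
Variables (m mu a eps : R).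
Hypotheses (kn : (k < n)%N) (e_sym : symmetric e).
Hypothesis e_sub : forall u v, e u v -> Bgraph_adj k u v.
Hypotheses (ki0 : (k <= i0)%N) (ne0 : ~~ e (inl i0) (inr j0)).
Hypotheses (mE : m = (n - k)%:R) (mu_gt0 : 0 < mu) (mu_sqr : mu * mu = n%:R * m).
Hypotheses (a_gt0 : 0 < a) (eps_gt0 : 0 < eps).

Let lw (i : 'I_n) : R := if (i < k)%N then a else 1.
(** [rub j - eps] is the sum of [lw] over the neighbours of [j] in [B^k_n]. *)
Let rub (j : 'I_n) : R := if (j < n - k)%N then m + eps else m + k%:R * a + eps.
Let rw (j : 'I_n) : R := rub j - (j == j0)%:R.

Hypothesis row_ge : k%:R ^+ 2 * a + n%:R * eps < 1.
Hypothesis row_lt : k%:R * (m + k%:R * a + eps) < n%:R * m * a.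

(* Dividing the right-hand weights by [mu] leaves inequalities that involve only
   [mu ^+ 2 = n m]. *)
Definition test_vector (u : 'I_n + 'I_n) : R :=
  match u with inl i => lw i | inr j => rw j / mu end.

Let m_ge1 : 1 <= m.
Proof. by rewrite mE ler1n subn_gt0. Qed.

Let lw_gt0 i : 0 < lw i. Proof. by rewrite /lw; case: ifP. Qed.

Let rub_gt1 j : 1 < rub j.
Proof.
have ka : 0 <= k%:R * a by rewrite mulr_ge0 // ltW.
by rewrite /rub; case: ifP => _; move: m_ge1 eps_gt0 ka; lra.
Qed.

Let rw_gt0 j : 0 < rw j.
Proof. by have := rub_gt1 j; rewrite /rw; case: (j == j0) => /=; lra. Qed.

Let col_sum j : \sum_(i | e (inl i) (inr j)) lw i < rw j.
Proof.
have le1 : \sum_(i | e (inl i) (inr j)) lw i + (j == j0)%:R <=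
   \sum_(i | Bgraph_adj k (inl i) (inr j)) lw i.
  have [-> /=|_] := eqVneq j j0; last first.
    rewrite addr0 big_mkcond [leRHS]big_mkcond; apply: ler_sum => i _.
    case: ifP => [/e_sub -> //|_]; case: ifP => // _; exact: ltW.
  (* The missing edge [i0 j0] removes a term of weight 1 from column [j0], which pays for the 1
     subtracted in [rw j0]. *)
  rewrite [leRHS](bigD1 i0) /=; last by rewrite ltnNge ki0.
  rewrite [lw i0]/lw ltnNge ki0 /= [leLHS]addrC lerD2l.
  rewrite big_mkcond [leRHS]big_mkcond; apply: ler_sum => i _.
  case: ifP => [eij|_]; last by case: ifP => // _; apply: ltW.
  have /= -> := e_sub eij; have -> // : i != i0.
  by apply: contraNneq ne0 => <-.
have : \sum_(i | Bgraph_adj k (inl i) (inr j)) lw i = rub j - eps.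
  rewrite /rub /=; case: ifP => jm.
    rewrite big_mkcond (eq_bigr (fun i : 'I_n => if (i < k)%N then 0 else 1)).
      by rewrite sum_ord_lt 1?ltnW // -mE; ring.
    by move=> i _; rewrite andbT /lw; case: (i < k)%N.
  rewrite (eq_bigl xpredT) => [|i]; last by rewrite andbF.
  by rewrite sum_ord_lt 1?ltnW // -mE; ring.
move: le1 eps_gt0; rewrite /rw; lra.
Qed.

Let row_sum i : \sum_(j | e (inl i) (inr j)) rw j < n%:R * m * lw i.
Proof.
have [ik|ki] := ltnP i k.
  (* Such a row meets only the last [k] columns, each of weight at most [m + k a + eps]. *)
  apply: le_lt_trans (_ : k%:R * (m + k%:R * a + eps) < _); last first.
    by rewrite /lw ik.
  apply: le_trans (_ : \sum_(j < n)
      (if (j < n - k)%N then 0 else m + k%:R * a + eps) <= _).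
    rewrite big_mkcond; apply: ler_sum => j _; case: ifP => [/e_sub /=|_].
      rewrite ik /= => /negbTE jm; rewrite /rw /rub jm.
      by rewrite gerBl.
    by case: ifP => // jm; move: (rub_gt1 j); rewrite /rub jm; lra.
  by rewrite sum_ord_lt ?leq_subr // subKn 1?ltnW // mulr0 add0r.
apply: le_lt_trans (_ : \sum_j rw j < _).
  rewrite big_mkcond; apply: ler_sum => j _; case: ifP => // _; exact: ltW.
(* The full sum is [n m + k^2 a + n eps - 1], below [n m] by [row_ge]. *)
rewrite sumrB sum_ord_lt ?leq_subr // subKn 1?ltnW //.
rewrite (bigD1 j0) //= eqxx big1 => [|j /negbTE -> //].
rewrite -mE /lw ltnNge ki /= addr0.
have nE : n%:R = m + k%:R :> R by rewrite mE -natrD subnK 1?ltnW.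
move: row_ge; rewrite nE; lra.
Qed.

Lemma test_vector_gt0 u : 0 < test_vector u.
Proof. by case: u => [i|j] /=; rewrite ?divr_gt0. Qed.

Lemma test_vector_sum_lt u :
  \sum_(v | e u v) test_vector v < mu * test_vector u.
Proof.
rewrite big_mkcond big_sumType -!big_mkcond /=.
case: u => [i|j] /=.
  rewrite big1 ?add0r => [|i' /e_sub //].
  rewrite -mulr_suml ltr_pdivrMr // mulrAC mu_sqr; exact: row_sum.
rewrite [X in _ + X]big1 ?addr0 => [|j' /e_sub //].
rewrite (eq_bigl (fun i => e (inl i) (inr j))) => [|i]; last exact: e_sym.
rewrite mulrC divfK ?gt_eqF //; exact: col_sum.
Qed.

End TestVector.

Lemma test_weights (R : realType) (n k : nat) :
  (1 <= k)%N -> (k ^ 3 + 2 * k + 4 <= n)%N ->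
  exists a eps : R, [/\ 0 < a, 0 < eps, k%:R ^+ 2 * a + n%:R * eps < 1 &
    k%:R * ((n - k)%:R + k%:R * a + eps) < n%:R * (n - k)%:R * a].
Proof.
move=> k_ge1 n_ge; have kn : (k < n)%N by lia.
have : (k ^ 3 + 2 * k + 4)%:R <= n%:R :> R by rewrite ler_nat.
rewrite (natrD _ (_ + _)) (natrD _ (_ ^ _)) natrM natrX natrB 1?ltnW //.
have : 1 <= k%:R :> R by rewrite ler1n.
move: (k%:R) (n%:R) => K N K1 NK.
have K3 : 1 <= K ^+ 3 by rewrite exprn_ege1.
have K2 : 0 < K ^+ 2 by rewrite exprn_gt0 //; lra.
have N0 : 0 < N by lra.
(* [a = (1 - 1/n) / k^2], just below the bound [k^2 a < 1]. *)
exists ((N - 1) / (N * K ^+ 2)), (1 / (2 * N ^+ 2)); split.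
- by rewrite divr_gt0 ?mulr_gt0 //; lra.
- by rewrite divr_gt0 ?mulr_gt0 ?exprn_gt0 //; lra.
(* The choice of [a] leaves a slack of [1 / N], and [N eps] uses half of it. *)
- have -> : K ^+ 2 * ((N - 1) / (N * K ^+ 2)) + N * (1 / (2 * N ^+ 2)) =
    1 - (2 * N)^-1 by field; lra.
  by rewrite gtrBl invr_gt0; lra.
have -> : N * (N - K) * ((N - 1) / (N * K ^+ 2)) = (N - K) * (N - 1) / K ^+ 2.
  by field; lra.
rewrite ltr_pdivlMr //.
have -> : K * (N - K + K * ((N - 1) / (N * K ^+ 2)) + 1 / (2 * N ^+ 2)) * K ^+ 2 =
    K ^+ 3 * (N - K) + K ^+ 2 * (1 - N^-1) + K ^+ 3 / (2 * N ^+ 2).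
  by field; lra.
have : K ^+ 3 / (2 * N ^+ 2) < 1.
  by rewrite ltr_pdivrMr ?mulr_gt0 ?exprn_gt0 // mul1r; nra.
have : K ^+ 2 * (1 - N^-1) <= K ^+ 2.
  by apply: ler_piMr; [exact: ltW | rewrite gerBl invr_ge0 ltW].
(* It suffices that [K^2 + 1 <= (N - K) (N - 1 - K^3)]; the lower bound on [n] makes the last factor
   at least [2 K + 3]. *)
nra.
Qed.

Lemma min_degree_le (G : sgraph) (x : G) : (min_degree G <= degree x)%N.
Proof. by rewrite /min_degree -minEnat -leEnat; apply: bigmin_le_cond. Qed.

Theorem theorem1p6 (R : realType) (k n : nat) (G : sgraph)
    (hk : (1 <= k)%N) (hn : (k ^ 3 + 2 * k + 4 <= n)%N)
    (hbip : balanced_bipartite G) (hord : #|G| = (2 * n)%N)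
    (hsub : is_subgraph G (Bgraph n k)) (hdeg : (k <= min_degree G)%N) :
  ~ isomorphic G (Bgraph n k) ->
  spectral_radius R G < Num.sqrt (n%:R * (n%:R - k%:R)).
Proof.
move=> niso; case: hsub => f f_inj f_adj.
have kn : (k < n)%N by lia.
(* Both graphs have [2 n] vertices, so the embedding carries [G] onto a relation [e] on the vertices
   of [B^k_n]. *)
have [g fK gK] : bijective f.
  by apply: inj_card_bij => //; rewrite hord card_sum !card_ord; lia.
pose e (u v : 'I_n + 'I_n) := adj (g u) (g v).
have e_sym : symmetric e by move=> u v; apply: adj_sym.
have e_sub u v : e u v -> Bgraph_adj k u v by move/f_adj; rewrite !gK.
have [i0 [j0 [Bij ne0]]] : exists i0 j0,
    Bgraph_adj k (inl i0) (inr j0) /\ ~~ e (inl i0) (inr j0).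
  have [/existsP[i0 /existsP[j0 /andP[]]]|none] :=
      boolP [exists i0, exists j0, Bgraph_adj k (inl i0) (inr j0) &&
                                   ~~ e (inl i0) (inr j0)].
    by exists i0, j0.
  (* With no edge missing, [f] would be an isomorphism. *)
  have e_full i j : Bgraph_adj k (inl i) (inr j) -> e (inl i) (inr j).
    move=> Bij; apply: contraNT none => ne.
    by apply/existsP; exists i; apply/existsP; exists j; rewrite Bij.
  have {}e_full u v : Bgraph_adj k u v -> e u v.
    case: u v => [i|j] [i'|j'] //; first exact: e_full.
    by rewrite e_sym; apply: e_full.
  case: niso; exists f; first by exists g.
  move=> x y; apply/idP/idP; last exact: f_adj.
  by move/e_full; rewrite /e !fK.
(* If [i0 < k], the neighbours of [i0] lie among the last [k] right vertices; losing [j0] leaves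
   fewer than [k], against the minimum degree. *)
have ki0 : (k <= i0)%N.
  rewrite leqNgt; apply/negP => i0k.
  have : (k <= degree (g (inl i0)))%N by apply: leq_trans hdeg (min_degree_le _).
  rewrite /degree -(card_imset _ f_inj) leqNgt => /negP; apply.
  pose Q := [set j : 'I_n | (n - k <= j)%N].
  have cQ : #|Q| = k.
    rewrite -sum1dep_card big_mkcond /=.
    rewrite (eq_bigr (fun j : 'I_n => if (j < n - k)%N then 0 else 1)%N); last first.
      by move=> j _; case: leqP.
    by rewrite (@sum_ord_lt nat) ?leq_subr // subKn 1?ltnW // mulr0 mulr1 natn.
  have j0Q : j0 \in Q by move: Bij; rewrite inE /= i0k /= -leqNgt.
  pose r (j : 'I_n) : Bgraph n k := inr j.
  have : (#|r @: (Q :\ j0)| < k)%N.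
    rewrite card_imset; last by move=> ? ? [].
    by rewrite -cQ [ltnRHS](cardsD1 j0) j0Q.
  apply: leq_ltn_trans; apply: subset_leq_card; apply/fintype.subsetP => u.
  case/imsetP => y; rewrite inE => gy ->.
  have ef : e (inl i0) (f y) by rewrite /e fK.
  have := e_sub _ _ ef; case fy: (f y) ef => [i|j] //= ef.
  rewrite i0k /= -leqNgt => jQ; apply: (imset_f r); rewrite !inE jQ andbT.
  by apply: contraNneq ne0 => <-.
have [a [eps [a_gt0 eps_gt0 rge rlt]]] := @test_weights R n k hk hn.
rewrite -natrB 1?ltnW //.
have nm_gt0 : 0 < n%:R * (n - k)%:R :> R.
  by rewrite mulr_gt0 ?ltr0n ?subn_gt0 //; lia.
pose mu : R := Num.sqrt (n%:R * (n - k)%:R).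
have mu_gt0 : 0 < mu by rewrite sqrtr_gt0.
have mu_sqr : mu * mu = n%:R * (n - k)%:R by rewrite -expr2 sqr_sqrtr // ltW.
apply: (@spectral_radius_lt_weight R G
          (fun x => @test_vector R n k j0 (n - k)%:R mu a eps (f x))) => //.
- by move=> x; apply: test_vector_gt0.
move=> x; rewrite (reindex g); last by exists f => ? _.
under eq_bigr => u _ do rewrite gK.
rewrite (eq_bigl (e (f x))) => [|u]; last by rewrite /e fK.
exact: (@test_vector_sum_lt R n k e i0 j0).
Qed.
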